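(* The game CRIM restricted to rectangles is domestic but not tame, and returnable but not forced.
   Context: A rectangle is a partition $[c^r]$ with $r,c\ge1$ ($r$ parts all equal to $c$), or the empty partition $[\,]$. A move of CRIM removes one row or one column from the Young diagram of a partition, with the remaining pieces re-attached to form a partition. CRIM on rectangles is the game whose positions are the rectangles, including $[\,]$. From $[c^r]$ with $r,c\ge1$ the moves lead to $[c^{r-1}]$ and $[(c-1)^r]$, where a rectangle with zero rows or zero columns is $[\,]$. The only terminal position is $[\,]$. The Sprague-Grundy value $\mathcal{G}(\lambda)$ is the minimal excluded nonnegative integer (mex) of the values $\mathcal{G}(\mu)$ over all $\mu$ reachable from $\lambda$ in one move, so terminal positions have value $0$. The misère Grundy value $\mathcal{G}^-(\lambda)$ satisfies the same mex recursion at non-terminal positions, but terminal positions have $\mathcal{G}^-=1$. A position is called an $(a,b)$-position if its Conway pair $(\mathcal{G}(\lambda),\mathcal{G}^-(\lambda))$ equals $(a,b)$. A game is: - returnable if for any move from a $(0,1)$-position (resp. a $(1,0)$-position) to a non-terminal position $y$, there is a move from $y$ to a $(0,1)$-position (resp. to a $(1,0)$-position); - forced if each move from a $(0,1)$-position results in a $(1,0)$-position and vice versa; - domestic if it has neither $(0,k)$-positions nor $(k,0)$-positions with $k\ge2$; - tame if it has only $(0,1)$-positions, $(1,0)$-positions, and $(k,k)$-positions with $k\ge0$. *)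

(* Defs.v *)
From mathcomp Require Import all_boot.

Set Implicit Arguments.
Unset Strict Implicit.
Unset Printing Implicit Defensive.

Lemma mex_exists (s : seq nat) : exists n, n \notin s.
Proof.
exists (\max_(i <- s) i).+1; apply/negP => h.
by have := @leq_bigmax_seq _ s predT id _ h isT; rewrite ltnn.
Qed.

Definition mex (s : seq nat) : nat := ex_minn (mex_exists s).

Lemma mex_eq (s : seq nat) (m : nat) :
  m \notin s -> (forall k, k < m -> k \in s) -> mex s = m.
Proof.
move=> hm hlt; rewrite /mex; case: ex_minnP => n hn hmin.
apply/eqP; rewrite eqn_leq hmin //= leqNgt.
by apply/negP => /hlt; rewrite (negPf hn).
Qed.

(* Finitely branching impartial games; [rank] only witnesses that every play
   ends, and the values below do not depend on it (see [grundyE], [misereE]). *)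
Record game := Game {
  pos : eqType;
  options : pos -> seq pos;
  rank : pos -> nat;
  rank_lt : forall x y, y \in options x -> rank y < rank x
}.

Section Values.
Variable G : game.
Implicit Types x y z : pos G.

Definition terminal x : bool := nilp (options x).

(* [t] is the value of terminal positions and [n] bounds the recursion depth. *)
Fixpoint mex_value (t n : nat) x : nat :=
  if terminal x then t else
  if n is n'.+1 then mex [seq mex_value t n' y | y <- options x] else 0.

Definition grundy x : nat := mex_value 0 (rank x) x.

Definition misere x : nat := mex_value 1 (rank x) x.

Lemma mex_value_fuel t n m x :
  rank x <= n -> rank x <= m -> mex_value t n x = mex_value t m x.
Proof.
elim: n m x => [|n IHn] [|m] x //=; rewrite ?leqn0.
- move=> /eqP h _; case: ifP => //; rewrite /terminal.
  by case E: (options x) => [|y s] // _; have := @rank_lt G x y;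
    rewrite E mem_head h ltn0 => /(_ isT).
- move=> _ /eqP h; case: ifP => //; rewrite /terminal.
  by case E: (options x) => [|y s] // _; have := @rank_lt G x y;
    rewrite E mem_head h ltn0 => /(_ isT).
move=> hn hm; case: ifP => // _; congr mex; apply/eq_in_map => y /rank_lt hy.
by apply: IHn; rewrite -ltnS; apply: leq_trans hy _.
Qed.

Lemma mex_valueE t x :
  mex_value t (rank x) x =
  if terminal x then t
  else mex [seq mex_value t (rank y) y | y <- options x].
Proof.
case E: (rank x) => [|n] /=; last first.
  case: ifP => // _; congr mex; apply/eq_in_map => y /rank_lt hy.
  by apply: mex_value_fuel; rewrite // -ltnS -E.
case: ifP => //; rewrite /terminal.
by case F: (options x) => [|y s] // _; have := @rank_lt G x y;
  rewrite F mem_head E ltn0 => /(_ isT).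
Qed.

Lemma grundyE x : grundy x = mex [seq grundy y | y <- options x].
Proof.
rewrite /grundy mex_valueE /terminal; case: (options x) => //=.
by rewrite (@mex_eq [::] 0).
Qed.

Lemma misereE x :
  misere x = if terminal x then 1 else mex [seq misere y | y <- options x].
Proof. exact: mex_valueE. Qed.

Definition conway_pair x : nat * nat := (grundy x, misere x).

Definition returnable : Prop :=
  forall x y, y \in options x -> ~~ terminal y ->
    (conway_pair x = (0, 1) ->
       exists2 z, z \in options y & conway_pair z = (0, 1)) /\
    (conway_pair x = (1, 0) ->
       exists2 z, z \in options y & conway_pair z = (1, 0)).

Definition forced : Prop :=
  forall x y, y \in options x ->
    (conway_pair x = (0, 1) -> conway_pair y = (1, 0)) /\
    (conway_pair x = (1, 0) -> conway_pair y = (0, 1)).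

Definition domestic : Prop :=
  forall x k, 2 <= k -> conway_pair x <> (0, k) /\ conway_pair x <> (k, 0).

Definition tame : Prop :=
  forall x, [\/ conway_pair x = (0, 1), conway_pair x = (1, 0)
              | exists k, conway_pair x = (k, k)].

End Values.

Arguments returnable : clear implicits.
Arguments forced : clear implicits.
Arguments domestic : clear implicits.
Arguments tame : clear implicits.

Section Restriction.
Variables (G : game) (P : pred (pos G)).

Definition sub_options (x : {x : pos G | P x}) : seq {x : pos G | P x} :=
  pmap insub (options (val x)).

Lemma sub_rank_lt (x y : {x : pos G | P x}) :
  y \in sub_options x -> rank (val y) < rank (val x).
Proof. by rewrite mem_pmap_sub => /rank_lt. Qed.

Definition restrict : game := Game sub_rank_lt.

End Restriction.

Definition is_partition (s : seq nat) : bool := sorted geq s && (0 \notin s).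

Definition partition_of := {s : seq nat | is_partition s}.

Definition remove_row (i : nat) (s : seq nat) : seq nat :=
  take i s ++ drop i.+1 s.

(* Columns are numbered from 0, so a part p meets column j iff j < p. *)
Definition remove_col (j : nat) (s : seq nat) : seq nat :=
  [seq p <- [seq p - (j < p) | p <- s] | p != 0].

Definition crim_moves (s : seq nat) : seq (seq nat) :=
  [seq remove_row i s | i <- iota 0 (size s)] ++
  [seq remove_col j s | j <- iota 0 (head 0 s)].

Lemma crim_moves_partition (s t : seq nat) :
  is_partition s -> t \in crim_moves s -> is_partition t.
Proof.
case/andP=> srt n0; rewrite mem_cat => /orP[] /mapP[i _ ->]; apply/andP; split.
- apply: subseq_sorted srt; first by move=> a b c /= h1 h2; apply: leq_trans h2 h1.
  rewrite -{2}(cat_take_drop i s) /remove_row.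
  rewrite cat_subseq // -addn1 addnC -drop_drop.
  exact: drop_subseq.
- apply: contra n0; rewrite mem_cat => /orP[/mem_take|/mem_drop] //.
- apply: sorted_filter; first by move=> a b c /= h1 h2; apply: leq_trans h2 h1.
  rewrite sorted_map; apply: sub_sorted srt => a b /= ba.
  case: (ltnP i a) => ia; case: (ltnP i b) => ib /=; rewrite ?subn0 ?leq_sub2r //.
  + by rewrite subn1 -ltnS prednK ?(leq_trans _ ia) // (leq_ltn_trans ib ia).
  + by rewrite (leq_trans _ ba) // leq_subr.
- by rewrite mem_filter eqxx.
Qed.

Lemma crim_moves_sumn (s t : seq nat) :
  is_partition s -> t \in crim_moves s -> sumn t < sumn s.
Proof.
case/andP=> _ n0; rewrite mem_cat => /orP[] /mapP[i]; rewrite mem_iota /= add0n.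
  move=> ilt ->; rewrite -{2}(cat_take_drop i s) (drop_nth 0) //.
  rewrite /remove_row !sumn_cat /= ltn_add2l -[X in X < _]add0n ltn_add2r lt0n.
  by apply: contra n0 => /eqP <-; rewrite mem_nth.
move=> ilt ->; have filt (u : seq nat) : sumn [seq p <- u | p != 0] = sumn u.
  by elim: u => //= [[|a] u] /= ->.
rewrite /remove_col filt; case: s n0 ilt => //= a s _ ia; rewrite ia.
rewrite -addSn leq_add //; first by rewrite subn1 prednK // (leq_ltn_trans _ ia).
by elim: s => //= b s IH; rewrite leq_add // leq_subr.
Qed.

(* [crim_moves_partition] makes [insub] total here: no move is discarded
   (see [crim_optionsE]). *)
Definition crim_options (l : partition_of) : seq partition_of :=
  pmap insub (crim_moves (val l)).

Lemma crim_optionsE (l : partition_of) :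
  [seq val m | m <- crim_options l] = crim_moves (val l).
Proof.
rewrite /crim_options pmap_filter; last exact: insubK.
apply/all_filterP/allP => t ht.
by rewrite isSome_insub; apply: crim_moves_partition (valP l) ht.
Qed.

Lemma crim_rank_lt (l m : partition_of) :
  m \in crim_options l -> sumn (val m) < sumn (val l).
Proof. by rewrite mem_pmap_sub => /(crim_moves_sumn (valP l)). Qed.

Definition crim : game := Game crim_rank_lt.

Definition is_rectangle (l : partition_of) : bool := constant (val l).

Lemma is_rectangleP (l : partition_of) :
  reflect (val l = [::] \/
           exists r c, [/\ 1 <= r, 1 <= c & val l = nseq r c])
          (is_rectangle l).
Proof.
case: l => s /= hs; rewrite /is_rectangle /=; apply: (iffP idP).
  case: s hs => [|c s] hs /=; first by left.
  move/all_pred1P => E; right; exists (size s).+1, c; split=> //=; last by rewrite -E.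
  by case/andP: hs => _; rewrite inE negb_or eq_sym lt0n => /andP[].
by case=> [->|[[|r] [c [_ _ ->]]]] //=; apply/all_pred1P; rewrite size_nseq.
Qed.

Definition crim_rectangles : game := @restrict crim is_rectangle.

Lemma crim_rectangles_options (r c : nat) (x y : pos crim_rectangles) :
  val (val x) = nseq r.+1 c.+1 ->
  (y \in options x) =
    (val (val y) == nseq r c.+1) ||
    (val (val y) == if c is 0 then [::] else nseq r.+1 c).
Proof.
move=> xE; rewrite mem_pmap_sub mem_pmap_sub xE mem_cat; congr orb.
  have rowE i : i < r.+1 -> remove_row i (nseq r.+1 c.+1) = nseq r c.+1.
    move=> ir; rewrite /remove_row take_nseq; last exact: ltnW.
    by rewrite drop_nseq -nseqD subSS subnKC.
  apply/mapP/eqP => [[i]|->]; last by exists 0; rewrite ?rowE // mem_iota size_nseq.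
  by rewrite mem_iota size_nseq => /rowE ->.
have colE i : i < c.+1 ->
    remove_col i (nseq r.+1 c.+1) = if c is 0 then [::] else nseq r.+1 c.
  move=> ic; rewrite /remove_col map_nseq ic subn1 filter_nseq.
  by case: c {xE ic} => [|c]; rewrite ?mul0n ?mul1n.
apply/mapP/eqP => [[i]|->]; last by exists 0; rewrite ?colE.
by rewrite mem_iota => /colE ->.
Qed.

(* Main.v *)
Require Import Defs.
From mathcomp Require Import all_boot.

(** The Conway pair of the r x c rectangle has a closed form, symmetric in r
    and c: (0,1) if r c = 0; on the line r = 1 it alternates between (1,0) and
    (2,2); on the line r = 2 it alternates, from c = 2 on, between (0,0) and
    (2,1); and for r, c >= 3 it is (0,0) or (1,1) according to the parity of
    r + c.  Hence the only (0,1)-position is the empty one and the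
    (1,0)-positions are the lines of odd length: a non-terminal move from such
    a line shortens it by one, and so does the answer.  The 2 x 3 rectangle, a
    (2,1)-position, refutes tameness, and the move from a line of length 3 to
    one of length 2 refutes forcedness. *)

(** Minimality uses membership only. This absorbs repeated options: equal rectangles arise from each
    removed row or column. *)
Lemma eq_mex (s t : seq nat) : s =i t -> mex s = mex t.
Proof.
move=> st; rewrite {2}/mex; case: ex_minnP => n nt nmin.
apply: mex_eq => [|k kn]; rewrite st //.
by apply: contraLR kn => /nmin; rewrite -leqNgt.
Qed.

(** A form that reduces by computation, unlike [mex], which rests on [ex_minn]. *)
Definition mex2 (a b : nat) : nat :=
  if 0 \notin [:: a; b] then 0 else if 1 \notin [:: a; b] then 1 else 2.

Lemma mex_pair (a b : nat) : mex [:: a; b] = mex2 a b.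
Proof.
rewrite /mex2; case: ifPn => [n0|/negPn h0]; first exact: mex_eq.
case: ifPn => [n1|/negPn h1]; first by apply: mex_eq => // -[].
apply: mex_eq => [|[|[]] //].
(* Two entries that include 0 and 1 leave no room for 2. *)
by move: h0 h1; rewrite !inE; case: a b => [|[|a]] [|[|b]].
Qed.

(* The height is reset to 0 when c = 0, as [nseq r 0] is not a partition. *)
Definition rect_parts (r c : nat) : seq nat := nseq (if c is 0 then 0 else r) c.

Lemma rect_parts_partition (r c : nat) : is_partition (rect_parts r c).
Proof.
rewrite /rect_parts /is_partition mem_nseq; case: c => [|c] //=.
by rewrite andbF andbT; elim: r => // -[|r] //= ->; rewrite andbT /geq /= leqnn.
Qed.

Definition rect_partition (r c : nat) : partition_of :=
  exist _ (rect_parts r c) (rect_parts_partition r c).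

Lemma rect_partition_rectangle (r c : nat) : is_rectangle (rect_partition r c).
Proof. by rewrite /is_rectangle /= /rect_parts; exact: constant_nseq. Qed.

Definition rect (r c : nat) : pos crim_rectangles :=
  exist _ (rect_partition r c) (rect_partition_rectangle r c).

Lemma rectP (x : pos crim_rectangles) : exists r c, x = rect r c.
Proof.
have /is_rectangleP[E|[r [c [_ c1 E]]]] := valP x.
  by exists 0, 0; do 2!apply: val_inj.
by exists r, c; do 2!apply: val_inj; case: c c1 E.
Qed.

Lemma options_rect (r c : nat) (y : pos crim_rectangles) :
  (y \in options (rect r.+1 c.+1)) = (y \in [:: rect r c.+1; rect r.+1 c]).
Proof.
rewrite (@crim_rectangles_options r c) // !inE -!val_eqE /=.
(* For [c = 0] the reset height makes both sides empty. *)
by congr (_ || (_ == _)); case: c.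
Qed.

Lemma terminal_rect (r c : nat) : terminal (rect r c) = (r == 0) || (c == 0).
Proof.
case: r c => [|r] [|c] //; apply/nilP => o0.
by have := options_rect r c (rect r c.+1); rewrite o0 inE eqxx.
Qed.

Definition rect_value (r c : nat) : nat * nat :=
  match r, c with
  | 0, _ | _, 0 => (0, 1)
  | 1, m.+1 | m.+1, 1 => if odd m then (2, 2) else (1, 0)
  | 2, m.+2 | m.+2, 2 => if odd m then (2, 1) else (0, 0)
  | r'.+3, c'.+3 => if odd (r' + c') then (1, 1) else (0, 0)
  end.

Lemma rect_value_rec (r c : nat) :
  let p := rect_value r c.+1 in let q := rect_value r.+1 c in
  rect_value r.+1 c.+1 = (mex2 p.1 q.1, mex2 p.2 q.2).
Proof.
(* Once each argument is split into 0, 1, 2 and at least 3, only a parity remains to be decided. *)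
by case: r c => [|[|[|r]]] [|[|[|c]]] //=;
  rewrite ?addn0 ?addnS ?addSn /= ?negbK //; case: (odd _).
Qed.

Lemma conway_pair_rect (r c : nat) : conway_pair (rect r c) = rect_value r c.
Proof.
have zero (x : pos crim_rectangles) : terminal x -> conway_pair x = (0, 1).
  move=> tx; rewrite /conway_pair misereE tx grundyE.
  by rewrite (nilP tx) (@mex_eq [::] 0).
(* [IHr] covers the removal of a row, the inner [IHc] that of a column. *)
elim: r c => [|r IHr] c; first by rewrite zero ?terminal_rect.
elim: c => [|c IHc].
  by rewrite zero ?terminal_rect ?orbT //; case: r {IHr} => [|[]].
rewrite rect_value_rec -IHr -IHc /conway_pair /= grundyE misereE terminal_rect /=.
by congr pair; rewrite -mex_pair; apply: eq_mex; exact: eq_mem_map (options_rect r c).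
Qed.

Lemma rect_value01 (r c : nat) : rect_value r c = (0, 1) -> terminal (rect r c).
Proof.
by rewrite terminal_rect; case: r c => [|[|[|r]]] [|[|[|c]]] //=; case: (odd _).
Qed.

Lemma rect_value10 (r c : nat) : rect_value r c = (1, 0) ->
  exists n, (r, c) = (1, n.*2.+1) \/ (r, c) = (n.*2.+1, 1).
Proof.
move=> v; have : (r == 1) && odd c || (c == 1) && odd r.
  by move: v; case: r c => [|[|[|r]]] [|[|[|c]]] //=; rewrite ?negbK; case: (odd _).
case/orP=> /andP[/eqP-> o].
  by exists c./2; left; rewrite -[in LHS](odd_double_half c) o.
by exists r./2; right; rewrite -[in LHS](odd_double_half r) o.
Qed.

Lemma rect_line_value (n : nat) :
  rect_value 1 n.*2.+1 = (1, 0) /\ rect_value n.*2.+1 1 = (1, 0).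
Proof. by case: n => //= n; rewrite odd_double. Qed.

Theorem theorem22 :
  (domestic crim_rectangles /\ ~ tame crim_rectangles) /\
  (returnable crim_rectangles /\ ~ forced crim_rectangles).
Proof.
split; split.
- move=> x [|[|k]] // _; have [r [c ->]] := rectP x; rewrite conway_pair_rect.
  by case: r c => [|[|[|r]]] [|[|[|c]]] //=; case: (odd _).
- by move=> /(_ (rect 2 3)); rewrite conway_pair_rect => -[//|//|[k [<-]]].
- move=> x y; have [r [c ->]] := rectP x => xy nty.
  rewrite conway_pair_rect; split=> [/rect_value01 tx|/rect_value10[n v]].
    by move: xy; rewrite (nilP tx).
  (* Removing the line itself, or the only cell when [n = 0], ends the game; only shortening a
     longer line needs an answer. *)
  case: v xy nty => -[-> ->]; rewrite options_rect !inE => /orP[]/eqP->;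
    rewrite terminal_rect ?orbT //; case: n => // n _.
  + exists (rect 1 n.*2.+1); first by rewrite options_rect !inE eqxx orbT.
    by rewrite conway_pair_rect; case: (rect_line_value n).
  + exists (rect n.*2.+1 1); first by rewrite options_rect mem_head.
    by rewrite conway_pair_rect; case: (rect_line_value n).
- move=> /(_ (rect 1 3) (rect 1 2)); rewrite options_rect !inE eqxx orbT !conway_pair_rect.
  by case=> // _ /(_ erefl).
Qed.
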